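(* Fix any $u\in(0,1/8)$. For any $\sigma>0$, $n\ge2$, $p>1$, any integer length $1\le r\le n/4$, any integer sparsity $1\le s\le p$, and any estimator $\hat\tau$, there exists $\Theta\in\bar{\mathcal P}(u,r,s)$ such that, with $\mathbb P_\Theta$-probability larger than $1/4$, at least one of the two following properties is satisfied: - $\hat\tau$ contains at least one spurious change-point (that is, (NoSp) fails); - at least one change-point $\tau_k$ with $1\le k\le K$ is not detected, i.e. there is no estimated change-point in the interval $[(\tau_{k-1}+\tau_k)/2,(\tau_k+\tau_{k+1})/2]$.
   Context: For $\Theta=(\theta_1,\dots,\theta_n)\in\mathbb R^{p\times n}$, $\mathbb P_\Theta$ is the distribution of $Y=(y_1,\dots,y_n)$ with $y_t=\theta_t+\varepsilon_t$, $\varepsilon_t$ i.i.d. $\mathcal N(0,\sigma^2I_p)$. The change-points of $\Theta$ are the integers $1=\tau_0<\tau_1<\dots<\tau_K<\tau_{K+1}=n+1$ such that $\theta_t=\mu_k$ for $\tau_k\le t<\tau_{k+1}$ and $\mu_k\neq\mu_{k-1}$. Put $\Delta_k=\|\mu_k-\mu_{k-1}\|$ (Euclidean norm), $r_k=\min(\tau_{k+1}-\tau_k,\tau_k-\tau_{k-1})$, $s_k=\|\mu_k-\mu_{k-1}\|_0$ (number of nonzero coordinates). $\bar{\mathcal P}(u,r,s)$ is the set of all $\Theta$ (with arbitrary $K\ge0$; constant $\Theta$, i.e. $K=0$, belong to it) such that every change-point $\tau_k$, $1\le k\le K$, satisfies $r_k\ge r$, $s_k\le s$ and $$r_k\Delta_k^2\ge\frac12\sigma^2\Big[s_k\log\Big(1+u\frac{\sqrt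 p}{s_k}\sqrt{\log\big(\tfrac n{r_k}\big)}\Big)+u\log\big(\tfrac n{r_k}\big)\Big].$$ An estimator $\hat\tau=(\hat\tau_1,\dots,\hat\tau_{\hat K})$ is any measurable function of $Y$ with values in finite increasing vectors. (NoSp): for all $1\le k\le K$ the interval $[\tau_k-\frac{\tau_k-\tau_{k-1}}2,\tau_k+\frac{\tau_{k+1}-\tau_k}2]$ contains at most one $\hat\tau_{k'}$, and all $\hat\tau_{k'}$ lie in $[\tau_1-\frac{\tau_1-1}2,\tau_K+\frac{n+1-\tau_K}2]$; for $K=0$ it means $\hat K=0$, i.e. any estimated change-point is spurious. *)

(* Defs.v *)
From HB Require Import structures.
From mathcomp Require Import all_boot all_order all_algebra.
From mathcomp Require Import all_classical all_reals all_analysis.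
From mathcomp Require Import measurable_realfun.

Set Implicit Arguments.
Unset Strict Implicit.
Unset Printing Implicit Defensive.

Import Order.TTheory GRing.Theory Num.Theory.

Local Open Scope classical_set_scope.
Local Open Scope ring_scope.

Section product_law.
Context d (T : measurableType d) (R : realType).

Let cons_pair k (x : T * k.-tuple T) : k.+1.-tuple T := [tuple of x.1 :: x.2].

Let measurable_cons_pair k : measurable_fun [set: T * k.-tuple T] (@cons_pair k).
Proof. exact: (measurable_cons measurable_fst measurable_snd). Qed.

HB.instance Definition _ k :=
  isMeasurableFun.Build _ _ _ _ (@cons_pair k) (@measurable_cons_pair k).

(* The k-fold product of P with itself; see iid_lawE. *)
Fixpoint iid_law (P : probability T R) (k : nat) : probability (k.-tuple T) R :=
  match k with
  | 0 => \d_ ([tuple] : 0.-tuple T)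
  | k'.+1 => distribution (P \x iid_law P k')%E (@cons_pair k')
  end.

Lemma iid_lawE (P : probability T R) k (A : 'I_k -> set T) :
  (forall i, measurable (A i)) ->
  iid_law P k [set x | forall i, A i (tnth x i)] = (\prod_(i < k) P (A i))%E.
Proof.
elim: k A => [|k IHk] A mA /=.
  by rewrite big_ord0 diracE mem_set// => -[].
rewrite big_ord_recl -(IHk (fun i => A (lift ord0 i))) => [|i]; last exact: mA.
have mB : measurable [set x : k.-tuple T | forall i, A (lift ord0 i) (tnth x i)].
  rewrite (_ : [set x | _] =
     \bigcap_(i in [set: 'I_k]) ((@tnth k T)^~ i @^-1` A (lift ord0 i))).
    apply: fin_bigcap_measurable => [|i _]; first exact: finite_finset.
    by rewrite -[X in measurable X]setTI; exact: measurable_tnth.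
  by apply/seteqP; split=> x /= Ax i; [move=> _|]; apply: Ax.
rewrite -(product_measure1E P (iid_law P k) (mA ord0) mB).
rewrite /distribution /pushforward; congr (_ _).
apply/seteqP; split=> -[x y] /=.
  move=> Axy; split; first by have := Axy ord0; rewrite tnth0.
  by move=> i; have := Axy (lift ord0 i); rewrite tnthS.
move=> [Ax Ay] i; case: (unliftP ord0 i) => [j ->|->]; last by rewrite tnth0.
by rewrite tnthS; exact: Ay.
Qed.

End product_law.

Section model.
Context (R : realType) (p n : nat).

(* The columns y_1, ..., y_n of the observation, as a tuple of tuples because
   these (unlike matrices) carry the product sigma-algebra. *)
Definition data := n.-tuple (p.-tuple (measurableTypeR R)).

Definition add_noise (Theta : 'M[R]_(p, n)) (e : data) : data :=
  [tuple [tuple Theta i t + tnth (tnth e t) i | i < p] | t < n].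

Lemma measurable_add_noise Theta : measurable_fun [set: data] (add_noise Theta).
Proof.
apply/measurable_fun_tnthP => t; apply/measurable_fun_tnthP => i.
rewrite [X in measurable_fun _ X](_ : _ =
    fun e : data => Theta i t + tnth (tnth e t) i); last first.
  by apply/funext => e; rewrite /= !tnth_mktuple.
apply: measurable_funD; first exact: measurable_cst.
exact: (measurableT_comp (measurable_tnth i) (measurable_tnth t)).
Qed.

HB.instance Definition _ Theta :=
  isMeasurableFun.Build _ _ _ _ (add_noise Theta) (measurable_add_noise Theta).

(* The second parameter of normal_prob is the standard deviation. *)
Definition data_law (sigma : R) (Theta : 'M[R]_(p, n)) : probability data R :=
  distribution (iid_law (iid_law (normal_prob 0 sigma) p) n) (add_noise Theta).

(* Times run over 1, ..., n, time t being column t.-1 of Theta.  Only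
   tau 0, ..., tau K.+1 and mu 0, ..., mu K are constrained; later values are
   never used. *)
Definition change_points (Theta : 'M[R]_(p, n)) (K : nat) (tau : nat -> nat)
    (mu : nat -> 'cV[R]_p) : Prop :=
  [/\ tau 0%N = 1%N /\ tau K.+1 = n.+1,
      forall k, (k <= K)%N -> (tau k < tau k.+1)%N,
      forall k (t : 'I_n), (k <= K)%N ->
        (tau k <= t.+1 < tau k.+1)%N -> col t Theta = mu k &
      forall k, (1 <= k <= K)%N -> mu k <> mu k.-1].

Definition norm2 (v : 'cV[R]_p) : R := Num.sqrt (\sum_i v i 0 ^+ 2).

Definition norm0 (v : 'cV[R]_p) : nat := #|[pred i | v i 0 != 0]|.

Definition jump (mu : nat -> 'cV[R]_p) k : R := norm2 (mu k - mu k.-1).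

Definition sparsity (mu : nat -> 'cV[R]_p) k : nat := norm0 (mu k - mu k.-1).

Definition seg_length (tau : nat -> nat) k : nat :=
  minn (tau k.+1 - tau k) (tau k - tau k.-1).

Definition Pbar (u sigma : R) (r s : nat) : set 'M[R]_(p, n) :=
  [set Theta | exists K tau mu, change_points Theta K tau mu /\
    forall k, (1 <= k <= K)%N ->
      let rk := seg_length tau k in
      let sk := sparsity mu k in
      [/\ (r <= rk)%N, (sk <= s)%N &
          rk%:R * jump mu k ^+ 2 >=
          2^-1 * sigma ^+ 2 *
          (sk%:R * ln (1 + u * (Num.sqrt p%:R / sk%:R) *
                           Num.sqrt (ln (n%:R / rk%:R)))
           + u * ln (n%:R / rk%:R))]].

(* An estimate is a strictly increasing finite sequence of reals, not
   necessarily integers.  Measurability is with respect to the disjoint union, over the length k, of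
   the Borel sigma-algebras of R^k. *)
Definition is_estimator (tauhat : data -> seq R) : Prop :=
  (forall y, sorted <%R (tauhat y)) /\
  forall k (B : set (k.-tuple (measurableTypeR R))), measurable B ->
    measurable (tauhat @^-1` ((fun t => tval t) @` B)).

Definition around (tau : nat -> nat) (k : nat) (x : R) : bool :=
  (tau k)%:R - ((tau k)%:R - (tau k.-1)%:R) / 2 <= x <=
  (tau k)%:R + ((tau k.+1)%:R - (tau k)%:R) / 2.

Definition NoSp (K : nat) (tau : nat -> nat) (est : seq R) : Prop :=
  if K == 0%N then est = [::] else
  (forall k, (1 <= k <= K)%N -> (count (around tau k) est <= 1)%N) /\
  (forall x, x \in est ->
     (tau 1%N)%:R - ((tau 1%N)%:R - 1) / 2 <= x <=
     (tau K)%:R + (n.+1%:R - (tau K)%:R) / 2).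

Definition detected (tau : nat -> nat) (est : seq R) (k : nat) : Prop :=
  exists2 x : R, x \in est &
    ((tau k.-1)%:R + (tau k)%:R) / 2 <= x <= ((tau k)%:R + (tau k.+1)%:R) / 2.

End model.

(* Main.v *)
Require Import Defs.
From HB Require Import structures.
From mathcomp Require Import all_boot all_order all_algebra.
From mathcomp Require Import all_classical all_reals all_analysis.
From mathcomp Require Import measurable_realfun.
From mathcomp Require Import ring lra zify.

Import Order.TTheory GRing.Theory Num.Theory.
Local Open Scope classical_set_scope.
Local Open Scope ring_scope.

(** The proof is a two-point argument in the style of Le Cam: the constant
    signal 0 is tested against a mixture of signals with one change-point.

    Every constraint of [Pbar u sigma r s] other than the two bounds
    involving [r] and [s] is expressed with the actual length and sparsity of
    the change-point.  It is therefore enough to look at the least favourable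
    member of the family: let h be the integral part of n / 2, and let
    [spike a h i] be the signal equal to a on row i and the columns 1, ..., h,
    and to 0 elsewhere.  It has a single change-point, of sparsity 1 <= s and
    of length h >= n / 4 >= r, and a is chosen so that the energy condition
    holds with equality ([spike_Pbar]).

    If all error probabilities were at most 1/4, then the event A that tauhat
    is non-empty would have probability at most 1/4 under the signal 0, where
    any estimated change-point is spurious, and at least 3/4 under each spike,
    since an estimate that makes no error has exactly one element
    ([spike_success]).  The average over i of the laws of the spikes has a
    density M with respect to the law of the noise, and integrating
    6 M <= M^2 + 9 over A gives 6 * 3/4 <= E M^2 + 9/4 ([second_moment_bound]),
    that is, E M^2 >= 9/4.

    On the other hand, the Gaussian likelihood ratios L_Theta satisfy
    E (L_Theta L_Theta') = exp (<Theta, Theta'> / sigma^2)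
    ([integral_lik_ratioM]) and two distinct spikes are orthogonal, hence
    E M^2 = 1 + (exp (h a^2 / sigma^2) - 1) / p.  Here h a^2 / sigma^2 is half
    of ln (1 + u sqrt p sqrt L) + u L with L = ln (n / h) <= 2 since n <= 3 h,
    so that for u < 1/8 the exponential is less than 1 + 5 p / 4
    ([expR_energy_lt]) and E M^2 < 9/4, a contradiction.

    The likelihood ratio of a shifted Gaussian matrix comes from translation
    invariance of the Lebesgue measure in dimension 1
    ([has_density_normal_shift]) and from the stability of densities under
    products ([has_density_iid_law]), used once for the rows and once for the
    columns. *)

(** * Shifts of Gaussian measures on the line *)

(** The image of [P] under [S] has density [g] with respect to [P].  Testing
    against non-negative functions instead of sets is what makes the property
    stable under products by iterated integration. *)
Definition has_density {d} {T : measurableType d} {R : realType}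
    (P : set T -> \bar R) (S : T -> T) (g : T -> R) : Prop :=
  forall f : T -> \bar R, measurable_fun [set: T] f ->
    (forall x, 0 <= f x)%E ->
    (\int[P]_x f (S x) = \int[P]_x (f x * (g x)%:E))%E.

Section gaussian_shift.
Context {R : realType}.
Local Notation mu := (@lebesgue_measure R).
Local Notation mR := (measurableTypeR R).

Lemma lebesgue_measure_shift (a : R) (A : set mR) : measurable A ->
  pushforward mu (fun x : mR => a + x : mR) A = mu A.
Proof.
move=> mA; have mS : measurable_fun [set: mR] (fun x : mR => a + x : mR).
  exact: measurable_funD.
pose S : {mfun mR >-> mR} := HB.pack (fun x : mR => a + x : mR)
  (isMeasurableFun.Build _ _ _ _ _ mS).
apply/esym.
apply: (@lebesgue_measure_unique _ (pushforward mu S)) => //= _ [[b c]] _ <-.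
rewrite /pushforward/= (_ : _ @^-1` _ = `]b - a, c - a]%classic); last first.
  apply/seteqP; split=> x /=; rewrite !in_itv/=; first by move=> ?; lra.
  by move=> ?; lra.
rewrite !lebesgue_measure_itv/= !lte_fin ltrD2r; case: ifPn => // _.
by rewrite -!EFinD; congr EFin; ring.
Qed.

Lemma ge0_integral_shift (a : R) (f : mR -> \bar R) :
  measurable_fun [set: mR] f -> (forall x, 0 <= f x)%E ->
  (\int[mu]_x f (a + x)%R = \int[mu]_x f x)%E.
Proof.
move=> mf f0; have mS : measurable_fun [set: mR] (fun x : mR => a + x : mR).
  exact: measurable_funD.
transitivity (\int[pushforward mu (fun x : mR => (a + x)%R : mR)]_x f x)%E.
  by rewrite ge0_integral_pushforward.
apply: eq_measure_integral => A mA _; exact: lebesgue_measure_shift.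
Qed.

(** [normal_pdf] agrees almost everywhere with the Radon-Nikodym derivative of
    [normal_prob], for which the change of measure is known. *)
Lemma ge0_integral_normal_prob (m s : R) (f : mR -> \bar R) :
  measurable_fun [set: mR] f -> (forall x, 0 <= f x)%E ->
  (\int[normal_prob m s]_x f x = \int[mu]_x (f x * (normal_pdf m s x)%:E))%E.
Proof.
move=> mf f0.
rewrite -(Radon_Nikodym_SigmaFinite.change_of_variables
  (normal_prob_dominates m s) f0)//.
set g := Radon_Nikodym_SigmaFinite.f _ _.
have ig : mu.-integrable setT g.
  exact: Radon_Nikodym_SigmaFinite.f_integrable (normal_prob_dominates m s).
have mg := measurable_int _ ig.
have mpdf : measurable_fun setT (EFin \o normal_pdf m s).
  by apply/measurable_EFinP; exact: measurable_normal_pdf.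
apply: ae_eq_integral => //; [exact: emeasurable_funM..|].
apply: ae_eqe_mul2l; apply: integral_ae_eq => // E _ mE.
by rewrite -Radon_Nikodym_SigmaFinite.f_integral//; exact: normal_prob_dominates.
Qed.

(** The likelihood ratio of N(theta, s^2) with respect to N(0, s^2). *)
Definition normal_ratio (s theta x : R) : R :=
  expR ((theta * x - theta ^+ 2 / 2) / s ^+ 2).

Lemma measurable_normal_ratio s theta :
  measurable_fun [set: mR] (normal_ratio s theta).
Proof.
apply: measurableT_comp => //; apply: measurable_funM => //.
by apply: measurable_funB => //; exact: measurable_funM.
Qed.

(** The cross term of the two shifts factors out: this is the source of
    the closed formula for the moments of likelihood ratios. *)
Lemma normal_ratio_shift s theta theta' x :
  normal_ratio s theta (theta' + x) =
  expR (theta * theta' / s ^+ 2) * normal_ratio s theta x.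
Proof. by rewrite -expRD; congr expR; ring. Qed.

Lemma has_density_normal_shift (s theta : R) : s != 0 ->
  has_density (normal_prob 0 s) (fun x : mR => theta + x : mR)
    (normal_ratio s theta).
Proof.
move=> s0 f mf f0.
have mpdf a : measurable_fun [set: mR] (EFin \o normal_pdf a s).
  by apply/measurable_EFinP; exact: measurable_normal_pdf.
have mS : measurable_fun [set: mR] (fun x : mR => theta + x : mR).
  exact: measurable_funD.
have mg := measurable_normal_ratio s theta.
rewrite ge0_integral_normal_prob//; last exact: measurableT_comp.
rewrite ge0_integral_normal_prob; last 2 first.
- by apply: emeasurable_funM => //; exact/measurable_EFinP.
- by move=> x; rewrite mule_ge0 ?lee_fin ?expR_ge0.
rewrite -[RHS](ge0_integral_shift theta); last 2 first.
- apply: emeasurable_funM; last exact: mpdf.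
  by apply: emeasurable_funM => //; exact/measurable_EFinP.
- by move=> x; rewrite !mule_ge0 ?lee_fin ?expR_ge0 ?normal_pdf_ge0.
apply: eq_integral => x _; rewrite -muleA; congr (_ * _)%E.
rewrite -EFinM !normal_pdfE//; congr EFin.
rewrite mulrCA; congr (_ * _); rewrite -expRD; congr expR.
by field.
Qed.

End gaussian_shift.

(** * Densities of product measures *)

Section product_density.
Context {d} {T : measurableType d} {R : realType}.

Definition map_coords {k} (S : 'I_k -> T -> T) (x : k.-tuple T) : k.-tuple T :=
  [tuple S i (tnth x i) | i < k].

Lemma measurable_map_coords {k} {S : 'I_k -> T -> T} :
  (forall i, measurable_fun [set: T] (S i)) ->
  measurable_fun [set: k.-tuple T] (map_coords S).
Proof.
move=> mS; apply/measurable_fun_tnthP => i.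
rewrite [X in measurable_fun _ X](_ : _ = fun x => S i (tnth x i)); last first.
  by apply/funext => x; rewrite /= tnth_mktuple.
exact: measurableT_comp (mS i) (measurable_tnth i).
Qed.

Lemma measurable_prod_tnth {k} (g : 'I_k -> T -> R) :
  (forall i, measurable_fun [set: T] (g i)) ->
  measurable_fun [set: k.-tuple T] (fun x => \prod_(i < k) g i (tnth x i)).
Proof.
move=> mg; apply: measurable_prod => i _.
exact: measurableT_comp (mg i) (measurable_tnth i).
Qed.

(** By induction on [k] with Tonelli's theorem: for each value of the
    head, the induction hypothesis turns the shift of the tail into a density;
    the hypothesis on the head is then applied to the resulting partial
    integral. *)
Lemma has_density_iid_law (P : probability T R) {k} {S : 'I_k -> T -> T}
    {g : 'I_k -> T -> R} :
  (forall i, measurable_fun [set: T] (S i)) ->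
  (forall i, measurable_fun [set: T] (g i)) ->
  (forall i x, 0 <= g i x) ->
  (forall i, has_density P (S i) (g i)) ->
  has_density (iid_law P k) (map_coords S)
    (fun x => \prod_(i < k) g i (tnth x i)).
Proof.
elim: k S g => [|k IHk] S g mS mg g0 dSg f mf f0.
  apply: eq_integral => x _; rewrite big_ord0 mule1; congr f.
  by apply: eq_from_tnth => -[].
have prod_ge0 (x : k.-tuple T) :
    (0 <= (\prod_(i < k) g (lift ord0 i) (tnth x i))%:E)%E.
  by rewrite lee_fin; apply: prodr_ge0.
have mcons : measurable_fun [set: T * k.-tuple T]
    (fun x => [tuple of x.1 :: x.2] : k.+1.-tuple T).
  exact: (measurable_cons measurable_fst measurable_snd).
have mprod := @measurable_prod_tnth k (fun i => g (lift ord0 i))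
  (fun i => mg (lift ord0 i)).
have fS0 x : (0 <= f (map_coords S x))%E by [].
have mfS : measurable_fun [set: k.+1.-tuple T] (fun x => f (map_coords S x)).
  apply: (measurableT_comp mf); exact: measurable_map_coords.
have fg0 (x : k.+1.-tuple T) :
    (0 <= f x * (\prod_(i < k.+1) g i (tnth x i))%:E)%E.
  by rewrite mule_ge0// lee_fin; apply: prodr_ge0.
have mfg : measurable_fun [set: k.+1.-tuple T]
    (fun x => f x * (\prod_(i < k.+1) g i (tnth x i))%:E)%E.
  apply: emeasurable_funM => //; apply/measurable_EFinP.
  exact: measurable_prod_tnth.
have mfcons : measurable_fun [set: T * k.-tuple T]
    (fun x => f [tuple of x.1 :: x.2]) by exact: measurableT_comp mf mcons.
rewrite /= !ge0_integral_distribution//.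
rewrite !fubini_tonelli1//; last 4 first.
- apply: (measurableT_comp mfg); exact: mcons.
- by move=> z; exact: fg0.
- apply: (measurableT_comp mfS); exact: mcons.
- by move=> z; exact: fS0.
(* The partial integral over the tail, as a function of the head. *)
pose F x := (\int[iid_law P k]_y
  (f [tuple of x :: y] * (\prod_(i < k) g (lift ord0 i) (tnth y i))%:E))%E.
have F0 x : (0 <= F x)%E by apply: integral_ge0 => y _; exact: mule_ge0.
have mF : measurable_fun [set: T] F.
  apply: (measurable_fun_fubini_tonelli_F (fun z : T * k.-tuple T =>
    f [tuple of z.1 :: z.2] *
    (\prod_(i < k) g (lift ord0 i) (tnth z.2 i))%:E)%E); last first.
    by move=> z; exact: mule_ge0.
  apply: emeasurable_funM => //; apply/measurable_EFinP.
  exact: measurableT_comp mprod measurable_snd.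
transitivity (\int[P]_x F (S ord0 x))%E.
  apply: eq_integral => x _; rewrite /fubini_F/= /F.
  rewrite -(IHk (fun i => S (lift ord0 i)) (fun i => g (lift ord0 i))
    _ _ _ _ (fun y => f [tuple of S ord0 x :: y]))//.
    apply: eq_integral => y _; congr f; apply: eq_from_tnth => i.
    rewrite tnth_mktuple; case: (unliftP ord0 i) => [j ->|->].
      by rewrite !tnthS tnth_mktuple.
    by rewrite !tnth0.
  by apply: (measurableT_comp mf); exact: measurable_cons.
rewrite (dSg ord0)//; apply: eq_integral => x _.
rewrite /F /fubini_F muleC -ge0_integralZl//.
- apply: eq_integral => y _; rewrite muleCA -EFinM /=; congr (_ * _%:E)%E.
  rewrite big_ord_recl tnth0; congr (_ * _).
  by apply: eq_bigr => i _; rewrite tnthS.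
- apply: emeasurable_funM; last exact/measurable_EFinP.
  by apply: (measurableT_comp mf); exact: measurable_cons.
- by move=> y _; exact: mule_ge0.
by rewrite lee_fin.
Qed.

End product_density.

(** * Likelihood ratios of the Gaussian sequence model *)

Section likelihood_ratio.
Context {R : realType} {p n : nat}.
Implicit Types (sigma : R) (Theta : 'M[R]_(p, n)).

Definition noise_law sigma : probability (data R p n) R :=
  iid_law (iid_law (normal_prob 0 sigma) p) n.

Definition lik_ratio sigma Theta (y : data R p n) : R :=
  \prod_(t < n) \prod_(i < p)
    normal_ratio sigma (Theta i t) (tnth (tnth y t) i).

Lemma lik_ratio_ge0 sigma Theta y : 0 <= lik_ratio sigma Theta y.
Proof. by do 2! apply: prodr_ge0 => ? _; exact: expR_ge0. Qed.

Lemma measurable_lik_ratio sigma Theta :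
  measurable_fun [set: data R p n] (lik_ratio sigma Theta).
Proof.
apply: (measurable_prod_tnth (fun t (x : p.-tuple (measurableTypeR R)) =>
  \prod_(i < p) normal_ratio sigma (Theta i t) (tnth x i))) => t.
apply: (measurable_prod_tnth (fun i => normal_ratio sigma (Theta i t))) => i.
exact: measurable_normal_ratio.
Qed.

Lemma has_density_add_noise sigma Theta : sigma != 0 ->
  has_density (noise_law sigma) (add_noise Theta) (lik_ratio sigma Theta).
Proof.
move=> s0.
have mS (a : R) : measurable_fun [set: measurableTypeR R]
    (fun x : measurableTypeR R => a + x : measurableTypeR R).
  exact: measurable_funD.
pose S t (x : p.-tuple (measurableTypeR R)) :=
  map_coords (fun i => fun x => Theta i t + x : measurableTypeR R) x.
rewrite (_ : add_noise Theta = map_coords S); last first.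
  apply/funext => y; apply: eq_from_tnth => t; apply: eq_from_tnth => i.
  by rewrite !tnth_mktuple.
pose g t (x : p.-tuple (measurableTypeR R)) :=
  \prod_(i < p) normal_ratio sigma (Theta i t) (tnth x i).
apply: (@has_density_iid_law _ _ _ (iid_law (normal_prob 0 sigma) p) n S g).
- by move=> t; exact: measurable_map_coords.
- move=> t; apply: (measurable_prod_tnth
    (fun i => normal_ratio sigma (Theta i t))) => i.
  exact: measurable_normal_ratio.
- by move=> t x; apply: prodr_ge0 => i _; exact: expR_ge0.
move=> t; apply: (@has_density_iid_law _ _ _ (normal_prob 0 sigma) p
  (fun i x => Theta i t + x) (fun i => normal_ratio sigma (Theta i t))).
- by move=> i; exact: mS.
- by move=> i; exact: measurable_normal_ratio.
- by move=> i x; exact: expR_ge0.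
- by move=> i; exact: has_density_normal_shift.
Qed.

Lemma data_lawE sigma Theta (A : set (data R p n)) : sigma != 0 ->
  measurable A -> data_law sigma Theta A =
  (\int[noise_law sigma]_y ((\1_A y)%:E * (lik_ratio sigma Theta y)%:E))%E.
Proof.
move=> s0 mA.
rewrite -(has_density_add_noise sigma Theta s0 (fun y => (\1_A y)%:E))//.
- have mTA : measurable (add_noise Theta @^-1` A).
    by rewrite -[X in measurable X]setTI; exact: measurable_add_noise.
  transitivity (\int[noise_law sigma]_y
      (\1_(add_noise Theta @^-1` A) y)%:E)%E; last first.
    by apply: eq_integral => y _; rewrite !indicE.
  by rewrite integral_indic// setIT.
- by apply/measurable_EFinP; exact: measurable_indic.
Qed.

Lemma data_law0 sigma : data_law sigma 0 = noise_law sigma :> (set _ -> \bar R).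
Proof.
apply/funext => A; rewrite /data_law/= /distribution /pushforward/=.
have -> : @add_noise R p n 0 = id; last by [].
apply/funext => y; apply: eq_from_tnth => t; apply: eq_from_tnth => i.
by rewrite !tnth_mktuple mxE add0r.
Qed.

Lemma lik_ratio_add_noise sigma Theta Theta' y :
  lik_ratio sigma Theta (add_noise Theta' y) =
  expR ((\sum_(t < n) \sum_(i < p) Theta i t * Theta' i t) / sigma ^+ 2) *
  lik_ratio sigma Theta y.
Proof.
rewrite mulr_suml expR_sum -big_split/=; apply: eq_bigr => t _.
rewrite mulr_suml expR_sum -big_split/=; apply: eq_bigr => i _.
by rewrite !tnth_mktuple normal_ratio_shift.
Qed.

Lemma integral_lik_ratio sigma Theta : sigma != 0 ->
  (\int[noise_law sigma]_y (lik_ratio sigma Theta y)%:E = 1)%E.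
Proof.
move=> s0; transitivity (data_law sigma Theta [set: data R p n]).
  rewrite data_lawE//; apply: eq_integral => y _.
  by rewrite indicT mul1e.
exact: probability_setT.
Qed.

(** Integrating against [lik_ratio sigma Theta'] amounts to adding [Theta'] to
    the noise, which multiplies [lik_ratio sigma Theta] by a constant. *)
Lemma integral_lik_ratioM sigma Theta Theta' : sigma != 0 ->
  (\int[noise_law sigma]_y
     ((lik_ratio sigma Theta y)%:E * (lik_ratio sigma Theta' y)%:E) =
   (expR ((\sum_(t < n) \sum_(i < p) Theta i t * Theta' i t) / sigma ^+ 2))%:E)%E.
Proof.
move=> s0.
rewrite -(has_density_add_noise sigma Theta' s0
  (fun y => (lik_ratio sigma Theta y)%:E)); last 2 first.
- by apply/measurable_EFinP; exact: measurable_lik_ratio.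
- by move=> y; rewrite lee_fin lik_ratio_ge0.
under eq_integral do rewrite lik_ratio_add_noise EFinM.
rewrite ge0_integralZl//.
- by rewrite integral_lik_ratio// mule1.
- by apply/measurable_EFinP; exact: measurable_lik_ratio.
- by move=> y _; rewrite lee_fin lik_ratio_ge0.
Qed.

(** With S the sum of the likelihood ratios, this is the integral over [A] of
    6 m S <= S^2 + 9 m^2, where the integral of S^2 over [A] is
    bounded by the one over the whole space.  The constant 3 = 6 / 2 is the optimal
    one when [A] has probability 1/4 under the noise and 3/4 on average under
    the shifted laws, since S / m then has conditional mean 3
    given [A]. *)
Lemma second_moment_bound sigma m (Theta : 'I_m -> 'M[R]_(p, n))
    (A : set (data R p n)) : sigma != 0 -> measurable A ->
  ((6 * m%:R)%:E * \sum_(j < m) data_law sigma (Theta j) A <=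
   (\sum_(j < m) \sum_(k < m) expR ((\sum_(t < n) \sum_(i < p)
     Theta j i t * Theta k i t) / sigma ^+ 2))%:E +
   (9 * m%:R ^+ 2)%:E * data_law sigma 0%R A)%E.
Proof.
move=> s0 mA; pose L j := lik_ratio sigma (Theta j).
have L0 j y : (0 <= (L j y)%:E)%E by rewrite lee_fin lik_ratio_ge0.
have mL j : measurable_fun [set: data R p n] (EFin \o L j).
  by apply/measurable_EFinP; exact: measurable_lik_ratio.
have mI : measurable_fun [set: data R p n] (EFin \o (\1_A : data R p n -> R)).
  by apply/measurable_EFinP; exact: measurable_indic.
have I0 y : (0 <= (\1_A y : R)%:E)%E by rewrite lee_fin.
have m0 : (0 <= (m%:R : R))%R by [].
have mIL j : measurable_fun [set: data R p n]
    (fun y => (\1_A y)%:E * (L j y)%:E)%E.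
  exact: (emeasurable_funM mI (mL j)).
have mLL j k : measurable_fun [set: data R p n]
    (fun y => (L j y)%:E * (L k y)%:E)%E.
  exact: (emeasurable_funM (mL j) (mL k)).
have IL0 j y : (0 <= (\1_A y)%:E * (L j y)%:E)%E by exact: mule_ge0.
have LL0 j k y : (0 <= (L j y)%:E * (L k y)%:E)%E by exact: mule_ge0.
have lawE : (\sum_(j < m) data_law sigma (Theta j) A =
    \int[noise_law sigma]_y \sum_(j < m) ((\1_A y)%:E * (L j y)%:E))%E.
  by rewrite ge0_integral_sum//; apply: eq_bigr => j _; rewrite data_lawE.
have law0E : (data_law sigma 0 A = \int[noise_law sigma]_y (\1_A y)%:E)%E.
  by rewrite data_law0 integral_indic// setIT.
have momentE : ((\sum_(j < m) \sum_(k < m) expR ((\sum_(t < n) \sum_(i < p)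
      Theta j i t * Theta k i t) / sigma ^+ 2))%:E =
    \int[noise_law sigma]_y
      \sum_(j < m) \sum_(k < m) ((L j y)%:E * (L k y)%:E))%E.
  rewrite -sumEFin ge0_integral_sum//; last 2 first.
  - by move=> j; exact: emeasurable_sum.
  - by move=> j y _; exact: sume_ge0.
  apply: eq_bigr => j _; rewrite -sumEFin ge0_integral_sum//.
  by apply: eq_bigr => k _; rewrite integral_lik_ratioM.
have mS : measurable_fun [set: data R p n]
    (fun y => \sum_(j < m) ((\1_A y)%:E * (L j y)%:E))%E.
  exact: emeasurable_sum.
have mSS : measurable_fun [set: data R p n]
    (fun y => \sum_(j < m) \sum_(k < m) ((L j y)%:E * (L k y)%:E))%E.
  by apply: emeasurable_sum => j; exact: emeasurable_sum.
have S0 y : (0 <= \sum_(j < m) ((\1_A y)%:E * (L j y)%:E))%E.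
  exact: sume_ge0.
have SS0 y : (0 <= \sum_(j < m) \sum_(k < m) ((L j y)%:E * (L k y)%:E))%E.
  by apply: sume_ge0 => j _; exact: sume_ge0.
have c0 : (0 <= (6 * m%:R : R)%:E)%E by rewrite lee_fin mulr_ge0.
have d0 : (0 <= (9 * m%:R ^+ 2 : R)%:E)%E by rewrite lee_fin mulr_ge0.
rewrite lawE law0E momentE -!ge0_integralZl// -ge0_integralD//; last first.
- exact: measurable_funeM.
apply: ge0_le_integral => //.
- by move=> y _; exact: mule_ge0.
- exact: measurable_funeM.
- by apply: emeasurable_funD => //; exact: measurable_funeM.
move=> y _; under eq_bigr do rewrite -EFinM.
under [X in (_ <= X + _)%E]eq_bigr do
  (under eq_bigr do rewrite -EFinM; rewrite sumEFin -mulr_sumr).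
rewrite !sumEFin -!EFinM -EFinD lee_fin -mulr_sumr -mulr_suml.
(* On A this is (s - 3 m)^2 >= 0, and off A it is s^2 >= 0. *)
set s := \sum_(j < m) _.
rewrite indicE; case: (y \in A); rewrite /= ?mul1r ?mul0r ?mulr1 ?mulr0 ?addr0.
  by have := sqr_ge0 (s - 3 * m%:R); rewrite sqrrB; nra.
exact: sqr_ge0.
Qed.

End likelihood_ratio.

(** * Signals with one change-point *)

Section spike.
Context {R : realType} {p n : nat}.

Definition spike (a : R) (h : nat) (i : 'I_p) : 'M[R]_(p, n) :=
  \matrix_(j, t) (a *+ ((j == i) && (t < h)%N)).

(** The default value of [nth] provides the end of the last segment. *)
Definition spike_tau (n h k : nat) : nat := nth n.+1 [:: 1; h.+1]%N k.

Definition spike_mu (a : R) (i : 'I_p) (k : nat) : 'cV[R]_p :=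
  \col_j (a *+ ((j == i) && (k == 0%N))).

Lemma spike_change_points a h i : a != 0 -> (0 < h < n)%N ->
  change_points (spike a h i) 1 (spike_tau n h) (spike_mu a i).
Proof.
move=> a0 /andP[h0 hn]; split=> //.
- by case=> [|[|]].
- move=> [|[|//]] t _ /andP[tl tr]; apply/colP => j; rewrite !mxE/=.
    by move: tr; rewrite /spike_tau/= ltnS => ->.
  by move: tl; rewrite /spike_tau/= ltnS leqNgt => /negbTE ->; rewrite andbF.
- move=> [//|[_|//]] /colP/(_ i); rewrite !mxE eqxx/= mulr0n mulr1n => a0'.
  by rewrite -a0' eqxx in a0.
Qed.

Lemma spike_jump a i : 0 <= a -> jump (spike_mu a i) 1 = a.
Proof.
move=> a0; rewrite /jump /norm2 (bigD1 i)//= big1 => [|j /negbTE ji].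
  by rewrite !mxE eqxx/= mulr0n sub0r sqrrN addr0 sqrtr_sqr ger0_norm.
by rewrite !mxE ji/= subrr expr0n.
Qed.

Lemma spike_sparsity a i : a != 0 -> sparsity (spike_mu a i) 1 = 1%N.
Proof.
move=> a0; rewrite /sparsity /norm0.
transitivity #|pred1 i|; last exact: card1.
apply: eq_card => j.
rewrite !inE !mxE andbF mulr0n sub0r oppr_eq0 andbT.
by case: (j == i); rewrite ?mulr1n ?a0// mulr0n eqxx.
Qed.

Lemma spike_dot a h i j : (h <= n)%N ->
  \sum_(t < n) \sum_(l < p) spike a h i l t * spike a h j l t =
  (h%:R * a ^+ 2) *+ (i == j).
Proof.
move=> hn; transitivity (\sum_(t < n | (t < h)%N) (a ^+ 2 *+ (i == j))).
  rewrite [RHS]big_mkcond/=; apply: eq_bigr => t _; rewrite (bigD1 i)//= big1.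
    rewrite !mxE eqxx/= addr0; case: ltnP => _; rewrite ?andbF ?mulr0n ?mulr0//.
    by rewrite andbT mulr1n mulrnAr expr2.
  by move=> l /negbTE li; rewrite !mxE li/= mulr0n mul0r.
rewrite (big_ord_narrow hn) sumr_const card_ord.
by rewrite mulrnAC; congr (_ *+ _); rewrite mulr_natl.
Qed.

Lemma sum_expR_spike_dot (sigma a : R) h : (h <= n)%N ->
  \sum_(j < p) \sum_(k < p) expR ((\sum_(t < n) \sum_(i < p)
    spike a h j i t * spike a h k i t) / sigma ^+ 2) =
  p%:R * (expR (h%:R * a ^+ 2 / sigma ^+ 2) + p%:R - 1).
Proof.
move=> hn; rewrite mulr_natl -[in RHS](card_ord p) -sumr_const.
apply: eq_bigr => j _; rewrite (bigD1 j)//= spike_dot// eqxx mulr1n -addrA.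
congr (_ + _); transitivity (\sum_(k < p | k != j) (1 : R)).
  apply: eq_bigr => k; rewrite eq_sym => /negbTE jk.
  by rewrite spike_dot// jk mulr0n mul0r expR0.
rewrite sumr_const cardC1 card_ord; case: {+}p j => [[]//|q _] /=.
by rewrite -natr1 addrK.
Qed.

(** For a single change-point, the interval where an estimate must lie not to
    be spurious, the one that must contain at most one estimate and the one
    that must contain some estimate all coincide, so that making no error means
    reporting exactly one point of this interval. *)
Lemma spike_success h (est : seq R) :
  ~ (~ NoSp n 1 (spike_tau n h) est \/
     exists2 k, (1 <= k <= 1)%N & ~ detected (spike_tau n h) est k) <->
  exists2 x, around (spike_tau n h) 1 x & est = [:: x].
Proof.
have detE (x : R) : (((spike_tau n h 0)%:R + (spike_tau n h 1)%:R) / 2 <= x <=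
    ((spike_tau n h 1)%:R + (spike_tau n h 2)%:R) / 2) =
    around (spike_tau n h) 1 x.
  by rewrite /around; congr (_ && _); apply/idP/idP => ?; lra.
split=> [/not_orP[/contrapT nosp nodet]|[x xI ->]].
  have [x xe xI] : detected (spike_tau n h) est 1.
    by apply: contra_notP nodet => nd; exists 1%N.
  rewrite detE in xI; exists x => //.
  move: nosp => [/(_ 1%N isT) cnt inI].
  have : all (around (spike_tau n h) 1) est by apply/allP => z /inI.
  rewrite all_count => /eqP allI.
  rewrite allI in cnt; move: cnt xe; case: est {inI allI nodet} => [|z [|]]//= _.
  by rewrite inE => /eqP ->.
have nosp : NoSp n 1 (spike_tau n h) [:: x].
  split=> [[|[|//]]// _|z]; first by rewrite /= xI.
  by rewrite inE => /eqP ->.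
case=> [/(_ nosp)//|[[|[|//]]// _]]; apply.
by exists x; rewrite ?inE ?detE.
Qed.

End spike.

Section least_favourable_spike.
Context {R : realType} {p n : nat}.
Context (u sigma : R) (sigma_gt0 : 0 < sigma).

Lemma zero_change_points : (0 < n)%N ->
  change_points (0 : 'M[R]_(p, n)) 0 (nth n.+1 [:: 1%N]) (fun=> 0).
Proof.
move=> n0; split=> // [[|//]|[|//] t _ _|[]//]; first by rewrite /= ltnS.
by apply/colP => j; rewrite !mxE.
Qed.

(** Half of the bracket in the energy condition, for sparsity 1. *)
Definition threshold (L : R) : R :=
  2^-1 * (ln (1 + u * Num.sqrt p%:R * Num.sqrt L) + u * L).

(** The height for which the energy condition of a spike of length h is an
    equality. *)
Definition spike_height (h : nat) : R :=
  sigma * Num.sqrt (threshold (ln (n%:R / h%:R)) / h%:R).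

Lemma threshold_gt0 L : 0 < u -> 0 < L -> 0 < threshold L.
Proof.
move=> u0 L0; rewrite /threshold mulr_gt0// ltr_wpDl ?mulr_gt0//.
by rewrite ln_ge0// lerDl !mulr_ge0 ?sqrtr_ge0// ltW.
Qed.

Lemma spike_heightE h : 0 < u -> (0 < h < n)%N ->
  0 < spike_height h /\
  h%:R * spike_height h ^+ 2 = sigma ^+ 2 * threshold (ln (n%:R / h%:R)).
Proof.
move=> u0 /andP[h0 hn].
have hR : 0 < h%:R :> R by rewrite ltr0n.
have t0 : 0 < threshold (ln (n%:R / h%:R)) / h%:R.
  rewrite divr_gt0// threshold_gt0// ln_gt0// ltr_pdivlMr// mul1r ltr_nat//.
split; first by rewrite mulr_gt0// sqrtr_gt0.
rewrite exprMn sqr_sqrtr ?ltW//; field; lra.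
Qed.

Lemma spike_Pbar r s h i : 0 < u -> (0 < r <= h)%N -> (h.*2 <= n)%N ->
  (0 < s)%N -> Pbar u sigma r s (spike (spike_height h) h i : 'M[R]_(p, n)).
Proof.
move=> u0 /andP[r0 rh] hn s0.
have hlt : (0 < h < n)%N by lia.
have [a0 aE] := spike_heightE h u0 hlt.
exists 1%N, (spike_tau n h), (spike_mu (spike_height h) i); split.
  by apply: spike_change_points => //; rewrite gt_eqF.
move=> [|[|//]]// _; rewrite spike_sparsity ?gt_eqF// spike_jump ?ltW//.
have -> : seg_length (spike_tau n h) 1 = h.
  by rewrite /seg_length /spike_tau /=; lia.
split=> //; rewrite aE /threshold divr1 mul1r.
by rewrite [X in _ <= X]mulrCA mulrA.
Qed.

End least_favourable_spike.

(** * The energy bound *)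

Section numeric.
Context {R : realType}.

(** Bounding the factor 1/2 by 1 in front of the logarithm and using
    sqrt (q L) <= sqrt (2 q) <= q, the exponential is at most
    (1 + q / 8) exp (1/8), with exp (1/8) <= 1 / (1 - 1/8) <= 2. *)
Lemma expR_energy_lt (u q L : R) : 0 < u < 8^-1 -> 2 <= q -> 0 <= L <= 2 ->
  expR (2^-1 * (ln (1 + u * Num.sqrt q * Num.sqrt L) + u * L)) < 1 + 5 / 4 * q.
Proof.
move=> /andP[u0 u8] q2 /andP[L0 L2].
set z := u * Num.sqrt q * Num.sqrt L.
have z0 : 0 <= z by rewrite !mulr_ge0 ?sqrtr_ge0// ltW.
have sq : Num.sqrt q * Num.sqrt L <= q.
  have q0 : 0 <= q by lra.
  rewrite -sqrtrM// -[leRHS]ger0_norm// -sqrtr_sqr ler_wsqrtr// expr2.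
  by rewrite ler_wpM2l// (le_trans L2).
have zq : z <= q / 8 by rewrite /z -mulrA; nra.
have e8 : expR (8^-1 : R) <= 2.
  have := expR_ge1Dx (- 8^-1 : R); rewrite expRN => h.
  rewrite -[leLHS]invrK invf_ple ?posrE ?invr_gt0 ?expR_gt0//; lra.
have lnz : 0 <= ln (1 + z) by rewrite ln_ge0//; lra.
apply: (@le_lt_trans _ _ (expR (ln (1 + z) + 8^-1))).
  by rewrite ler_expR; nra.
rewrite expRD lnK ?posrE; last lra.
apply: (@le_lt_trans _ _ ((1 + z) * 2)); first by rewrite ler_wpM2l//; lra.
lra.
Qed.

End numeric.

(** * Measurability of the decisions of an estimator *)

Section estimator.
Context {R : realType} {p n : nat} (tauhat : data R p n -> seq R).
Context (htauhat : is_estimator tauhat).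

Lemma measurable_estimator_nil : measurable [set y | tauhat y = [::]].
Proof.
rewrite (_ : [set _ | _] = tauhat @^-1` ((fun t : 0.-tuple R => tval t) @` setT)).
  exact: (htauhat.2 0%N setT measurableT).
apply/seteqP; split=> y /=.
  by move=> ->; exists [tuple].
by move=> [t _ <-]; rewrite tuple0.
Qed.

Lemma measurable_estimator_single (A : set (measurableTypeR R)) : measurable A ->
  measurable [set y | exists2 x, A x & tauhat y = [:: x]].
Proof.
move=> mA; pose B := [set t : 1.-tuple (measurableTypeR R) | A (tnth t ord0)].
have mB : measurable B.
  by rewrite -[B]setTI; exact: measurable_tnth.
rewrite (_ : [set _ | _] = tauhat @^-1` ((fun t => tval t) @` B)).
  exact: (htauhat.2 1%N).
apply/seteqP; split=> y /=.
  by move=> [x Ax ->]; exists [tuple x].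
by move=> [[[|x []]// st] Bt <-]; exists x.
Qed.

End estimator.

(** * The lower bound *)

Theorem corollary6 (R : realType) (u : R) (hu : 0 < u < 8^-1)
  (sigma : R) (hsigma : 0 < sigma)
  (n p : nat) (hn : (2 <= n)%N) (hp : (1 < p)%N)
  (r : nat) (hr : (1 <= r)%N /\ r%:R <= n%:R / 4 :> R)
  (s : nat) (hs : (1 <= s <= p)%N)
  (tauhat : data R p n -> seq R) (htauhat : is_estimator tauhat) :
  exists Theta : 'M[R]_(p, n),
    Pbar u sigma r s Theta /\
    exists (K : nat) (tau : nat -> nat) (mu : nat -> 'cV[R]_p),
      change_points Theta K tau mu /\
      ((4^-1)%:E < data_law sigma Theta
         [set y | ~ NoSp n K tau (tauhat y) \/
                  exists2 k, (1 <= k <= K)%N & ~ detected tau (tauhat y) k])%E.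
Proof.
have u0 : 0 < u by case/andP: hu.
have s0 : sigma != 0 by rewrite gt_eqF.
have n0 : (0 < n)%N by lia.
apply: contrapT => Hno.
have law_le Theta K tau mu : Pbar u sigma r s Theta ->
    change_points Theta K tau mu ->
    (data_law sigma Theta
       [set y | ~ NoSp n K tau (tauhat y) \/
          exists2 k, (1 <= k <= K)%N & ~ detected tau (tauhat y) k]
     <= (4^-1)%:E)%E.
  move=> PT cT; rewrite leNgt; apply/negP => lt4; apply: Hno.
  by exists Theta; split=> //; exists K, tau, mu.
pose A := ~` [set y | tauhat y = [::]].
have mA : measurable A.
  by apply: measurableC; exact: measurable_estimator_nil.
have null_le : (data_law sigma 0%R A <= (4^-1)%:E)%E.
  have c0 := @zero_change_points R p n n0.
  have P0 : Pbar u sigma r s (0 : 'M[R]_(p, n)).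
    by exists 0%N, (nth n.+1 [:: 1%N]), (fun=> 0); split=> // -[].
  apply: le_trans (law_le _ _ _ _ P0 c0).
  rewrite le_eqVlt; apply/orP; left; apply/eqP; congr (_ _).
  apply/seteqP; split=> y /=; first by left.
  by move=> [//|[[]//]].
pose h := n./2.
have hh : (h.*2 <= n)%N by rewrite /h; lia.
have n3h : (n <= 3 * h)%N by rewrite /h; lia.
have rh : (0 < r <= h)%N.
  case: hr => r0; rewrite ler_pdivlMr// -natrM ler_nat => r4.
  by rewrite /h; lia.
have hlt : (0 < h < n)%N by lia.
have s1 : (0 < s)%N by lia.
have [a0 aE] := @spike_heightE R p n u sigma hsigma h u0 hlt.
set a := @spike_height R p n u sigma h in a0 aE.
have alt_ge (i : 'I_p) : ((3 / 4)%:E <= data_law sigma (spike a h i) A)%E.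
  have cp : change_points (spike a h i : 'M[R]_(p, n)) 1 (spike_tau n h)
      (spike_mu a i).
    by apply: spike_change_points => //; rewrite gt_eqF.
  have PT := @spike_Pbar R p n u sigma hsigma r s h i u0 rh hh s1.
  (* By [spike_success], G is the event that no error is made. *)
  pose G := [set y | exists2 x, around (spike_tau n h) 1 x &
    tauhat y = [:: x]].
  have mG : measurable G.
    apply: (measurable_estimator_single tauhat htauhat
      [set x | around (spike_tau n h) 1 x]).
    rewrite [X in measurable X](_ : _ = `[
      (h.+1)%:R - ((h.+1)%:R - 1) / 2,
      (h.+1)%:R + ((n.+1)%:R - (h.+1)%:R) / 2]%classic)//.
  have := law_le _ _ _ _ PT cp.
  rewrite (_ : [set y | _] = ~` G); last first.
    apply/seteqP; split=> y /=.
      by move=> bad Gy; exact: ((spike_success h (tauhat y)).2 Gy bad).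
    by move=> nG; apply: contrapT => /(spike_success h (tauhat y)).1.
  rewrite probability_setC// => lawG.
  apply: (@le_trans _ _ (data_law sigma (spike a h i) G)); last first.
    by apply: le_measure; rewrite ?inE// => y [x _ yx]; rewrite /A/= yx.
  have fG := fin_num_measure (data_law sigma (spike a h i)) G mG.
  move: lawG; rewrite -(fineK fG) -EFinB !lee_fin => lawG.
  lra.
have := second_moment_bound sigma p (fun i => spike a h i) A s0 mA.
have hle : (h <= n)%N by lia.
rewrite sum_expR_spike_dot//.
rewrite aE mulrAC divff ?expf_neq0// mul1r.
set E := expR _ => bound.
have p2 : 2 <= p%:R :> R by rewrite ler_nat.
have EL : E < 1 + 5 / 4 * p%:R.
  have h0 : (0 < h%:R :> R) by rewrite ltr0n; case/andP: hlt.
  have n3 : n%:R <= 3 * h%:R :> R by rewrite -natrM ler_nat.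
  have hn' : h%:R <= n%:R :> R by rewrite ler_nat.
  apply: expR_energy_lt => //; rewrite ln_ge0 ?ler_pdivlMr ?mul1r//=.
  have -> : n%:R / h%:R = 1 + (n%:R / h%:R - 1) :> R by ring.
  have le3 : n%:R / h%:R <= 3 :> R by rewrite ler_pdivrMr.
  have gt0 : 0 < n%:R / h%:R :> R by rewrite divr_gt0//; lra.
  by apply: le_trans (le_ln1Dx _) _; lra.
have altS : ((p%:R * (3 / 4))%:E <=
    \sum_(j < p) data_law sigma (spike a h j) A)%E.
  rewrite mulr_natl -[X in _ *+ X](card_ord p) -sumr_const -sumEFin.
  exact: lee_sum.
have f0 := fin_num_measure (data_law sigma (0 : 'M[R]_(p, n))) A mA.
have := le_trans (lee_wpmul2l _ altS) bound.
rewrite lee_fin mulr_ge0// => /(_ isT).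
move: null_le; rewrite -(fineK f0) -!EFinM -EFinD !lee_fin => null_le.
(* 9/2 p^2 <= p (E + p - 1) + 9/4 p^2 contradicts the bound on E. *)
nra.
Qed.
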